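(* Let $A$ be an Abelian group and let $G=(V,E)$ be a weakly connected directed graph (loops and multiple edges allowed). In the rigid case, every function $g:V\to A$ on the set of vertices is balanceable; that is, $\mathcal{BR}(V,A)=A^V$, where $\mathcal{BR}(V,A)$ is the group of balanceable functions on the vertices of $G$ and $A^V$ is the group of all functions from $V$ to $A$.
   Context: The Abelian group $A$ is written additively with identity $0$. A directed graph $G=(V,E)$ has a nonempty vertex set $V$ and a set $E$ of directed edges, each with an origin and an endpoint in $V$; loops and multiple edges are allowed. It is weakly connected if its underlying undirected graph is connected. Rigid case (edges may be traversed only along their direction). A path from a vertex $x$ to a vertex $y$ is an alternating sequence $v_1,e_1,v_2,e_2,\dots,v_n,e_n$ of vertices from $V$ and pairwise different edges from $E$ such that $v_1=x$, each $e_j$ for $j=1,\dots,n-1$ goes from $v_j$ to $v_{j+1}$, and $e_n$ goes from $v_n$ to $y$; vertices may repeat. A cycle is a path from a vertex to itself. A function $g:V\to A$ is called balanceable if there exists a function $f:E\to A$ such that $g(v_1)+f(e_1)+g(v_2)+f(e_2)+\dots+g(v_n)+f(e_n)=0$ for every cycle $v_1,e_1,\dots,v_n,e_n$ of $G$. The set of all balanceable functions $g:V\to A$ is denoted $\mathcal{BR}(V,A)$; it is a group under pointwise addition. *)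

(* Defs.v *)
From Stdlib Require Import Relations List.
From HB Require Import structures.
From mathcomp Require Import all_boot all_order all_algebra.
From mathcomp Require Import boolp classical_sets functions.

Set Implicit Arguments.
Unset Strict Implicit.
Unset Printing Implicit Defensive.

Import GRing.Theory.
Local Open Scope classical_set_scope.
Local Open Scope ring_scope.

(* Vertex and edge sets may be infinite.  Edges form a type of their own, so
   that loops and multiple edges are allowed. *)
Record digraph := Digraph {
  vertex : Type;
  edge : Type;
  origin : edge -> vertex;
  endpoint : edge -> vertex;
  vertex_nonempty : inhabited vertex }.

Definition adjacent (G : digraph) (x y : vertex G) : Prop :=
  exists e : edge G, origin e = x /\ endpoint e = y.

(* Joined by a walk that may traverse edges in either direction. *)
Definition weakly_connected (G : digraph) : Prop :=
  forall x y : vertex G, clos_refl_sym_trans (vertex G) (@adjacent G) x y.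

(* The alternating sequence v_1, e_1, ..., v_n, e_n is the list of pairs
   (v_1, e_1), ..., (v_n, e_n). *)
Fixpoint leads (G : digraph) (x : vertex G) (p : seq (vertex G * edge G))
    (y : vertex G) : Prop :=
  match p with
  | [::] => x = y
  | (v, e) :: q => v = x /\ origin e = v /\ leads (endpoint e) q y
  end.

(* Vertex and edge types need no decidable equality, hence [NoDup] and not
   [uniq]. *)
Definition is_path (G : digraph) (x : vertex G)
    (p : seq (vertex G * edge G)) (y : vertex G) : Prop :=
  p <> [::] /\ NoDup [seq ve.2 | ve <- p] /\ leads x p y.

Definition is_cycle (G : digraph) (p : seq (vertex G * edge G)) : Prop :=
  exists x : vertex G, is_path x p x.

Definition balanceable (G : digraph) (A : zmodType) (g : vertex G -> A) : Prop :=
  exists f : edge G -> A, forall p : seq (vertex G * edge G),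
    is_cycle p -> \sum_(ve <- p) (g ve.1 + f ve.2) = 0.

Definition BR (G : digraph) (A : zmodType) : set (vertex G -> A) :=
  [set g | balanceable g].

Arguments BR : clear implicits.

Lemma BR_zmod_closed (G : digraph) (A : zmodType) :
  zmod_closed [in BR G A].
Proof.
split=> [|g h /[!inE] -[f fP] [k kP]].
  by rewrite inE; exists (fun=> 0) => p _; rewrite big1 // => ve _; rewrite addr0.
exists (fun e => f e - k e) => p p_cycle.
transitivity (\sum_(ve <- p) (g ve.1 + f ve.2)
              - \sum_(ve <- p) (h ve.1 + k ve.2)); last first.
  by rewrite fP // kP // subr0.
rewrite -sumrB.
by apply: eq_bigr => ve _; rewrite !fctE opprD addrACA.
Qed.

(* Main.v *)
Require Import Defs.
From mathcomp Require Import all_boot all_order all_algebra.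
From mathcomp Require Import boolp classical_sets functions.

Local Open Scope classical_set_scope.

(** An edge traversed along its direction is always preceded, in the
    alternating sequence of vertices and edges, by its own origin. So the edge
    weights [f e = - g (origin e)] balance [g]: each edge cancels the vertex
    just before it, and every cycle sums to zero term by term. *)

Lemma leads_sum_cancel_origin (A : zmodType) (G : digraph) (g : vertex G -> A)
    (p : seq (vertex G * edge G)) (x y : vertex G) :
  leads x p y -> (\sum_(ve <- p) (g ve.1 - g (origin ve.2)) = 0)%R.
Proof.
elim: p x => [|[v e] p IHp] x /=; first by rewrite big_nil.
by case=> _ [<- /IHp p_sum0]; rewrite big_cons p_sum0 GRing.subrr GRing.addr0.
Qed.

Theorem proposition3p2 (A : zmodType) (G : digraph) (hG : weakly_connected G) :
  BR G A = [set: vertex G -> A].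
Proof.
apply/seteqP; split=> // g _.
exists (fun e => - g (origin e))%R => p [x [_ [_ p_leads]]].
exact: leads_sum_cancel_origin p_leads.
Qed.
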